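(* Let $n \ge 4$ and let $q_0, \dots, q_n$ be real polynomials in one variable such that $q_0(0)=0$, $q_0'(0)=1$, $q_1(0)=0$, and $q_n$ is not identically zero. Then the system $$\dot x = -y, \qquad \dot y = q_0(x) + q_1(x) y + \dots + q_n(x) y^n$$ cannot commute with any polynomial system nonproportional to it; that is, every real polynomial vector field commuting with the vector field of this system is a constant multiple of it.
   Context: Two planar vector fields $(p,q)$ and $(r,s)$ (equivalently, the systems $\dot x=p,\ \dot y=q$ and $\dot x=r,\ \dot y=s$) commute if their Lie bracket vanishes identically, i.e. $$r p_x + s p_y - p r_x - q r_y = 0, \qquad r q_x + s q_y - p s_x - q s_y = 0.$$ *)

(* Defs.v *)
From mathcomp Require Import all_boot all_order all_algebra.
From mathcomp Require Import reals.

Set Implicit Arguments.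
Unset Strict Implicit.
Unset Printing Implicit Defensive.

Local Open Scope ring_scope.

(* Real polynomials in two variables are R[x][y]: the inner indeterminate is
   the coordinate x, the outer one is the coordinate y. *)
Definition bipoly (R : realType) := {poly {poly R}}.

Definition varY (R : realType) : bipoly R := 'X.
Definition ofX (R : realType) (f : {poly R}) : bipoly R := f%:P.
Definition constXY (R : realType) (c : R) : bipoly R := ofX c%:P.

Definition dx (R : realType) (f : bipoly R) : bipoly R := map_poly (@deriv R) f.
Definition dy (R : realType) (f : bipoly R) : bipoly R := f^`().

(* (p, q) stands for the system x' = p, y' = q. *)
Definition vfield (R : realType) := (bipoly R * bipoly R)%type.

Definition lie_bracket (R : realType) (v w : vfield R) : vfield R :=
  let: (p, q) := v in
  let: (r, s) := w in
  (r * dx p + s * dy p - p * dx r - q * dy r,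
   r * dx q + s * dy q - p * dx s - q * dy s).

Definition commute_vf (R : realType) (v w : vfield R) : Prop :=
  lie_bracket v w = (0, 0).

(* Only q 0, ..., q n matter. *)
Definition system (R : realType) (n : nat) (q : nat -> {poly R}) : vfield R :=
  (- varY R, \sum_(i < n.+1) ofX (q i) * varY R ^+ i).

Definition scale_vf (R : realType) (c : R) (v : vfield R) : vfield R :=
  (constXY c * v.1, constXY c * v.2).

(* Main.v *)
(* A commuting field (r, s) has s = y r_x - Q r_y, where Q is the second
   component of the system, and r solves a second order equation. Comparing
   coefficients of the highest power of y there gives m (m - 1) = 0 for
   m = deg_y r, so r = a(x) + b(x) y. The coefficient of y^(n+1) is then
   (n - 3) b' q_n, whence b is constant, and the coefficients of y^0 and y^n read
   a q_0' = a' q_0 and (n - 1) a' q_n + a q_n' = 0: the first one gives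
   a(0) = 0, the second one that a^(n-1) q_n is constant, so a = 0. *)
Require Import Defs.
From mathcomp Require Import all_boot all_order all_algebra.
From mathcomp Require Import reals.
From mathcomp Require Import zify ring.

Set Implicit Arguments.
Unset Strict Implicit.
Unset Printing Implicit Defensive.

Import GRing.Theory Num.Theory.

Local Open Scope ring_scope.

(** The degree bounds kill every term of the convolution except the one at (i, j). *)
Lemma coefM_top (A : nzRingType) (p q : {poly A}) (i j : nat) :
  (size p <= i.+1)%N -> (size q <= j.+1)%N -> (p * q)`_(i + j) = p`_i * q`_j.
Proof.
move=> hp hq.
have hi : (i < (i + j).+1)%N by rewrite ltnS leq_addr.
rewrite coefM (bigD1 (Ordinal hi)) //= addKn big1 ?addr0 // => k.
rewrite -val_eqE /= neq_ltn => /orP[lt_ki|lt_ik].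
  by rewrite [q`__]nth_default ?mulr0 //; apply: leq_trans hq _; lia.
by rewrite nth_default ?mul0r //; apply: leq_trans hp _.
Qed.

Lemma polyMn_eq0 (R : numDomainType) (p : {poly R}) (k : nat) :
  (p *+ k == 0) = (k == 0)%N || (p == 0).
Proof. by rewrite -scaler_nat -mul_polyC mulf_eq0 polyC_eq0 pnatr_eq0. Qed.

Lemma deriv_eq0_const (R : numDomainType) (p : {poly R}) :
  p^`() = 0 -> p = (p`_0)%:P.
Proof.
move=> dp0; apply/polyP => -[|i]; rewrite coefC //=.
move/(congr1 (fun u : {poly R} => u`_i)): dp0.
rewrite coef_deriv coef0 => /eqP.
by rewrite mulrn_eq0 /= => /eqP.
Qed.

(** Multiplied by a^(k-1), the equation says that (a^k f)' = 0. So a^k f is constant, and its value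
    at 0 is 0. *)
Lemma mulrn_deriv_eq0 (R : numDomainType) (a f : {poly R}) (k : nat) :
  (0 < k)%N -> a.[0] = 0 -> f != 0 ->
  a^`() * f *+ k + a * f^`() = 0 -> a = 0.
Proof.
case: k => // k _ a0 f_neq0 e.
have : (a ^+ k.+1 * f)^`() = 0.
  rewrite derivM deriv_exp /=.
  have -> : a^`() * a ^+ k *+ k.+1 * f + a ^+ k.+1 * f^`()
    = a ^+ k * (a^`() * f *+ k.+1 + a * f^`()).
    by rewrite exprSr; ring.
  by rewrite e mulr0.
move/deriv_eq0_const.
rewrite -horner_coef0 hornerM horner_exp a0 expr0n mul0r => /eqP.
by rewrite mulf_eq0 (negPf f_neq0) orbF expf_eq0 => /andP[_ /eqP].
Qed.

Section Dx.

Variable R : realType.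
Implicit Types (f g : bipoly R) (c : {poly R}).

Lemma coef_dx f i : (dx f)`_i = (f`_i)^`().
Proof. by rewrite coef_map. Qed.

Lemma size_dx f : (size (dx f) <= size f)%N.
Proof. exact: size_poly. Qed.

Lemma dxD f g : dx (f + g) = dx f + dx g.
Proof. exact: raddfD. Qed.

Lemma dxB f g : dx (f - g) = dx f - dx g.
Proof. exact: raddfB. Qed.

Lemma dxMX f : dx (f * 'X) = dx f * 'X.
Proof.
apply/polyP => i; rewrite !(coef_dx, coefMX).
by case: eqP; rewrite ?deriv0.
Qed.

Lemma dxC c : dx c%:P = c^`()%:P.
Proof.
apply/polyP => i; rewrite coef_dx !coefC.
by case: eqP; rewrite ?deriv0.
Qed.

Lemma dxMC f c : dx (f * c%:P) = dx f * c%:P + f * c^`()%:P.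
Proof. by apply/polyP => i; rewrite coefD !(coef_dx, coefMC) derivM. Qed.

End Dx.

Section Commuting.

Variables (R : realType) (n : nat) (Q r s : bipoly R).
Hypotheses (n_ge4 : (4 <= n)%N) (size_Q : size Q = n.+1).
(** [def_s] and [eq_s] are the two components of the bracket equation for (-y, Q) and (r, s), the
    first solved for s; ['X] is y. *)
Hypothesis def_s : s = 'X * dx r - Q * dy r.
Hypothesis eq_s : r * dx Q + s * dy Q + 'X * dx s - Q * dy s = 0.

Let Qn_neq0 : Q`_n != 0.
Proof. by rewrite -[n]/(n.+1.-1) -size_Q lead_coef_eq0 -size_poly_eq0 size_Q. Qed.

Lemma commuting_size : (size r <= 2)%N.
Proof.
rewrite leqNgt; apply/negP => r_gt2.
(* From here on deg_y r = m + 1 with m > 0. *)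
case def_m : (size r) r_gt2 => [|[|m]] // m_gt0.
have size_dyr : (size (dy r) <= m.+1)%N.
  by rewrite -ltnS -def_m lt_size_deriv // -size_poly_eq0 def_m.
have size_dyQ : (size (dy Q) <= n.-1.+1)%N.
  by rewrite prednK ?[(0 < n)%N]ltnW -1?ltnS -?size_Q ?lt_size_deriv
     -?size_poly_eq0 ?size_Q //; lia.
have size_s : (size s <= (n + m).+1)%N.
  rewrite def_s; apply: leq_trans (size_polyD _ _) _.
  rewrite size_polyN geq_max; apply/andP; split.
    apply: leq_trans (size_polyMleq _ _) _; rewrite size_polyX.
    by have := size_dx r; rewrite def_m; lia.
  by apply: leq_trans (size_polyMleq _ _) _; rewrite size_Q; move: (size (dy r)) size_dyr => k; lia.
(* Only Q r_y reaches degree n + m in y: y r_x has degree at most m + 2, which is smaller since n >=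
   4. *)
have top_s : s`_(n + m) = - (Q`_n * (r`_m.+1 *+ m.+1)).
  rewrite def_s coefB coefXM (coefM_top (p := Q)) ?size_Q // coef_deriv.
  rewrite [(dx r)`__]nth_default ?if_same ?sub0r //.
  by apply: leq_trans (size_dx r) _; rewrite def_m; lia.
have size_dys : (size (dy s) <= (n + m).-1.+1)%N.
  by apply: leq_trans (size_poly _ _) _; move: (size s) size_s => k; lia.
(* In degree 2n + m - 1 only s Q_y and Q s_y survive. They contribute n and n + m times s_(n+m) Q_n,
   so the difference is -m s_(n+m) Q_n. *)
have := congr1 (fun u : bipoly R => u`_(n + m + n.-1)) eq_s.
rewrite !(coefB, coefD) coef0.
have -> : (r * dx Q)`_(n + m + n.-1) = 0.
  apply: nth_default; apply: leq_trans (size_polyMleq _ _) _.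
  by have := size_dx Q; rewrite size_Q def_m; lia.
have -> : ('X * dx s)`_(n + m + n.-1) = 0.
  rewrite coefXM [(dx s)`__]nth_default ?if_same //.
  by apply: leq_trans (size_dx s) _; apply: leq_trans size_s _; lia.
rewrite coefM_top //.
have -> : (n + m + n.-1 = n + (n + m).-1)%N by lia.
rewrite coefM_top ?size_Q // /dy !coef_deriv.
have -> : ((n + m).-1.+1 = n + m)%N by lia.
have -> : n.-1.+1 = n by lia.
rewrite top_s add0r addr0 => /eqP.
have -> : - (Q`_n * (r`_m.+1 *+ m.+1)) * (Q`_n *+ n) -
    Q`_n * (- (Q`_n * (r`_m.+1 *+ m.+1)) *+ (n + m))
    = Q`_n ^+ 2 * r`_m.+1 *+ (m.+1 * m).
  ring.
rewrite polyMn_eq0 muln_eq0 /= (gtn_eqF (m_gt0 : (0 < m)%N)) /=.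
rewrite mulf_eq0 expf_eq0 (negPf Qn_neq0) andbF /=.
rewrite -[m.+1]/(m.+2.-1) -def_m -lead_coefE lead_coef_eq0.
by rewrite -size_poly_eq0 def_m.
Qed.

(** All terms with undifferentiated b cancel, as they must: a = 0 with b constant gives a multiple
    of the system itself. *)
Lemma commuting_eqn (a b : {poly R}) : r = a%:P + 'X * b%:P ->
  a%:P * dx Q + a^`()%:P * ('X * dy Q) + b^`()%:P * ('X^2 * dy Q)
  + a^`()^`()%:P * 'X^2 + b^`()^`()%:P * 'X^3
  - (b^`() *+ 3)%:P * ('X * Q) - a^`()%:P * Q = 0.
Proof.
move=> def_r.
have dxr : dx r = a^`()%:P + 'X * b^`()%:P.
  by rewrite def_r dxD mulrC dxMX !dxC mulrC.
have dyr : dy r = b%:P.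
  by rewrite def_r /dy !derivE mul1r mulr0 addr0 add0r.
have dxs : dx s =
    'X * (a^`()^`()%:P + 'X * b^`()^`()%:P) - (dx Q * b%:P + Q * b^`()%:P).
  rewrite def_s dxB dyr dxMC dxr [_ * (_ + _)]mulrC dxMX dxD mulrC.
  by rewrite ['X * b^`()%:P]mulrC dxMX !dxC [_ * 'X]mulrC.
have dys : dy s = a^`()%:P + 'X * b^`()%:P + 'X * b^`()%:P - dy Q * b%:P.
  rewrite def_s dyr dxr /dy !derivE; ring.
rewrite -[RHS]eq_s dxs dys def_s dxr dyr def_r polyCMn; ring.
Qed.

Lemma commuting_linear : (Q`_0).[0] = 0 -> (Q`_0)^`().[0] = 1 ->
  exists c : R, r = 'X * c%:P%:P.
Proof.
move=> Q00 dQ00; pose a := r`_0; pose b := r`_1.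
have def_r : r = a%:P + 'X * b%:P.
  apply/polyP => -[|[|i]]; rewrite coefD coefXM !coefC /= ?addr0 ?add0r //.
  by apply: nth_default; apply: leq_trans commuting_size _.
have coef_eqn i := congr1 (fun u : bipoly R => u`_i) (commuting_eqn def_r).
rewrite /= in coef_eqn.
(* In degree n + 1, y^2 Q_y contributes n Q_n and 3 y Q contributes 3 Q_n; the y^2 and y^3 terms lie
   lower, as n + 1 >= 5. *)
have db0 : b^`() = 0.
  have := coef_eqn n.+1; rewrite /dy.
  rewrite !(coefB, coefD, coefCM, coefXnM, coefXn, coefXM, coef0) coef_dx.
  rewrite !coef_deriv [(n.+1 < 2)%N]ltnNge ltnW ?ltnS; last lia.
  have -> : (n.+1 == 2)%N = false by lia.
  have -> : (n.+1 == 3)%N = false by lia.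
  have -> : ((n.+1 - 2).+1 = n)%N by lia.
  rewrite /=.
  rewrite nth_default ?size_Q // deriv0 !(mul0rn, mulr0, add0r, addr0, subr0).
  have -> : b^`() * (Q`_n *+ n) - b^`() *+ 3 * Q`_n = b^`() * Q`_n *+ (n - 3).
    rewrite mulrnBr; last lia.
    ring.
  move/eqP; rewrite polyMn_eq0 mulf_eq0 (negPf Qn_neq0) orbF.
  by rewrite subn_eq0 leqNgt n_ge4 => /eqP.
(* The coefficient of y^0 is a Q_0' - a' Q_0, whose value at x = 0 is a(0). *)
have a00 : a.[0] = 0.
  have := congr1 (horner^~ 0) (coef_eqn 0%N).
  rewrite db0 deriv0 mul0rn !(coefB, coefD, coefCM, coefXn, coefXM, coef0) /=.
  rewrite coef_dx !(mulr0, mul0r, addr0, subr0) !hornerE.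
  by rewrite Q00 dQ00 mulr1 mulr0 subr0.
(* In degree n, y Q_y contributes n a' Q_n and -a' Q removes one copy, hence the multiplicity n -
   1. *)
have a0 : a = 0.
  apply: (mulrn_deriv_eq0 (f := Q`_n) (k := n.-1)) => //; first lia.
  have := coef_eqn n.
  rewrite db0 deriv0 mul0rn !(coefB, coefD, coefCM, coefXn, coefXM, coef0) /=.
  have -> : (n == 0)%N = false by lia.
  have -> : (n == 2)%N = false by lia.
  rewrite coef_dx /dy coef_deriv prednK; last lia.
  rewrite !(mulr0, mul0r, addr0, subr0) => e.
  rewrite -[RHS]e -subn1 mulrnBr; last lia.
  ring.
by exists b`_0; rewrite {1}def_r a0 add0r -(deriv_eq0_const db0).
Qed.

End Commuting.

Lemma coef_system (R : realType) (n : nat) (q : nat -> {poly R}) (i : nat) :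
  (i <= n)%N -> ((system n q).2)`_i = q i.
Proof.
move=> le_in; rewrite /= coef_sum (bigD1 (Ordinal (le_in : (i < n.+1)%N))) //=.
rewrite coefCM coefXn eqxx mulr1 big1 ?addr0 // => j.
by rewrite -val_eqE /= coefCM coefXn eq_sym => /negPf->; rewrite mulr0.
Qed.

Lemma size_system (R : realType) (n : nat) (q : nat -> {poly R}) :
  q n != 0 -> size (system n q).2 = n.+1.
Proof.
move=> qn0; apply/eqP; rewrite eqn_leq; apply/andP; split; last first.
  rewrite ltnNge; apply: contra qn0 => /leq_sizeP/(_ n (leqnn n)).
  by rewrite coef_system // => ->.
apply: leq_trans (size_sum _ _ _) _; apply/bigmax_leqP => i _.
apply: leq_trans (size_polyMleq _ _) _; rewrite size_polyXn size_polyC.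
by have := ltn_ord i; case: (_ == _) => /=; lia.
Qed.

Theorem theorem5 (R : realType) (n : nat) (q : nat -> {poly R})
    (hn : (4 <= n)%N)
    (hq0 : (q 0%N).[0] = 0)
    (hdq0 : (q 0%N)^`().[0] = 1)
    (hq1 : (q 1%N).[0] = 0)
    (hqn : q n != 0)
    (w : vfield R)
    (hw : commute_vf (system n q) w) :
  exists c : R, w = scale_vf c (system n q).
Proof.
have size_Q := size_system hqn.
have Q0 := coef_system q (leq0n n).
case: w hw => r s; rewrite /commute_vf /lie_bracket.
rewrite [system n q]surjective_pairing /scale_vf.
move: (system n q).2 size_Q Q0 => Q size_Q Q0 /=.
have -> : dx (- varY R) = 0 :> bipoly R.
  by apply/polyP => i; rewrite coef_dx coefN coefX -polyCMn -polyCN derivC coef0.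
have -> : dy (- varY R) = - 1 :> bipoly R by rewrite /dy derivN derivX.
rewrite /varY => -[e1 e2].
have def_s : s = 'X * dx r - Q * dy r.
  by apply/eqP; rewrite -subr_eq0 -oppr_eq0 -[X in _ == X]e1; apply/eqP; ring.
have eq_s : r * dx Q + s * dy Q + 'X * dx s - Q * dy s = 0.
  by rewrite -[RHS]e2; ring.
have [||c def_r] := commuting_linear hn size_Q def_s eq_s.
- by rewrite Q0.
- by rewrite Q0.
(* The sign comes from r = c y against the first component -y of the system. *)
exists (- c); rewrite /constXY /ofX !polyCN def_s.
have -> : dx r = 0.
  by rewrite def_r mulrC dxMX dxC derivC mul0r.
have -> : dy r = c%:P%:P by rewrite def_r /dy !derivE mul1r mulr0 addr0.
by rewrite def_r; congr pair; ring.
Qed.
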